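(* Let $H, K$ be complex Hilbert spaces and let $T\in CR(H,K)\cap BR(H,K)$ have closed range. Define $$\mathcal{A}=\begin{bmatrix} 0 & T^{\dagger}\\ T & 0\end{bmatrix}=\bigl\{\{(x,y),(T^\dagger y,\,z)\}: \{x,z\}\in T,\ y\in K\bigr\},$$ a linear relation in $H\times K$. Then the resolvent set of $\mathcal{A}$ is $$\rho(\mathcal{A})=\{\lambda\in\mathbb{C}:\lambda^2\in\rho(TT^\dagger)\cap\rho(T^\dagger T)\}.$$
   Context: A linear relation from a Hilbert space $H$ into a Hilbert space $K$ is a linear subspace $T$ of $H\times K$, whose elements are written $\{x,y\}$; $CR(H,K)$ is the set of those that are closed subspaces. $D(T)=\{x:\{x,y\}\in T\text{ for some }y\}$, $R(T)=\{y:\{x,y\}\in T\text{ for some }x\}$, $N(T)=\{x:\{x,0\}\in T\}$, $M(T)=\{y:\{0,y\}\in T\}$, $T^{-1}=\{\{y,x\}:\{x,y\}\in T\}$; $T$ is an operator if $M(T)=\{0\}$ (operators are identified with their graphs). $Q_T$ is the quotient map $K\to K/\overline{M(T)}$; $T$ is continuous, $T\in BR(H,K)$, if the operator $Q_TT$ (on $D(T)$) is bounded. Products: $TS=\{\{x,y\}:\{x,z\}\in S,\ \{z,y\}\in T\text{ for some }z\}$. $P_W$ is the orthogonal projection onto a closed subspace $W$. The Moore–Penrose inverse of $T\in CR(H,K)$ is $T^\dagger=P_{N(T)^\perp}T^{-1}P_{R(T)}$ with domain $R(T)\oplus R(T)^\perp$; it is an operator, and has domain $K$ when $R(T)$ is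 closed. For $\lambda\in\mathbb{C}$, $S-\lambda=\{\{x,y-\lambda x\}:\{x,y\}\in S\}$. For a closed linear relation $S$ in a Hilbert space $X$, $\rho(S)$ is the set of $\lambda\in\mathbb{C}$ such that $(S-\lambda)^{-1}$ is a bounded operator with domain all of $X$. $H\times K$ is the Hilbert space direct sum. *)

(* Defs.v *)
From HB Require Import structures.
From mathcomp Require Import all_boot all_order all_algebra.
From mathcomp Require Import complex.
From mathcomp Require Import all_classical all_reals all_analysis.
From mathcomp Require Import ring.

Set Implicit Arguments.
Unset Strict Implicit.
Unset Printing Implicit Defensive.

Import Order.TTheory GRing.Theory Num.Theory.
Import numFieldNormedType.Exports.

Local Open Scope classical_set_scope.
Local Open Scope ring_scope.
Local Open Scope complex_scope.

(* {dot V for Num.conj} is linear in its first argument and conjugate-linear in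
   its second one. *)
HB.mixin Record isHilbert (R : realType) V & NormedModule R[i] V := {
  hdot : {dot V for @Num.conj R[i]} ;
  hnormE : forall x : V, `|x| ^+ 2 = hdot x x
}.

#[short(type="hilbertType")]
HB.structure Definition Hilbert (R : realType) :=
  {V of isHilbert R V & CompleteNormedModule R[i] V}.

(* The Hilbert direct sum is an alias of the product type because the library
   already equips H * K with the max norm, which is not a Hilbert norm. *)
Definition hsum (R : realType) (H K : hilbertType R) : Type := (H * K)%type.

Section HilbertSum.
Variables (R : realType) (H K : hilbertType R).
Implicit Types p q : hsum H K.

HB.instance Definition _ := GRing.Lmodule.copy (hsum H K) (H * K)%type.

Definition hsum_norm p : R[i] := sqrtC (`|p.1| ^+ 2 + `|p.2| ^+ 2).

Definition hsum_dot p q : R[i] := hdot p.1 q.1 + hdot p.2 q.2.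

Let sq_ge0 p : 0 <= `|p.1| ^+ 2 + `|p.2| ^+ 2.
Proof. by rewrite addr_ge0 ?exprn_ge0. Qed.

Let hsum_norm_ge0 p : 0 <= hsum_norm p.
Proof. by rewrite sqrtC_ge0 sq_ge0. Qed.

Let hsum_normD p q : hsum_norm (p + q) <= hsum_norm p + hsum_norm q.
Proof.
rewrite -(ler_pXn2r (n := 2)) ?nnegrE ?addr_ge0 ?hsum_norm_ge0//.
rewrite sqrrD !sqrtCK.
have CS : `|p.1| * `|q.1| + `|p.2| * `|q.2| <= hsum_norm p * hsum_norm q.
  rewrite -(ler_pXn2r (n := 2)) ?nnegrE ?addr_ge0 ?mulr_ge0 ?hsum_norm_ge0//.
  rewrite exprMn !sqrtCK -subr_ge0.
  rewrite [X in 0 <= X](_ : _ = (`|p.1| * `|q.2| - `|p.2| * `|q.1|) ^+ 2).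
    by apply: real_exprn_even_ge0 => //; rewrite rpredB ?rpredM ?normr_real.
  by ring.
have le2 (a b c : R[i]) : 0 <= a -> 0 <= b -> 0 <= c -> a <= b + c ->
    a ^+ 2 <= b ^+ 2 + b * c *+ 2 + c ^+ 2.
  by move=> a0 b0 c0 abc; rewrite -sqrrD ler_pXn2r ?nnegrE ?addr_ge0.
have h1 := le2 _ _ _ (normr_ge0 (p + q).1) (normr_ge0 p.1) (normr_ge0 q.1)
  (ler_normD p.1 q.1).
have h2 := le2 _ _ _ (normr_ge0 (p + q).2) (normr_ge0 p.2) (normr_ge0 q.2)
  (ler_normD p.2 q.2).
apply: (le_trans (lerD h1 h2)).
rewrite [leLHS](_ : _ = `|p.1| ^+ 2 + `|p.2| ^+ 2 +
  (`|p.1| * `|q.1| + `|p.2| * `|q.2|) *+ 2 + (`|q.1| ^+ 2 + `|q.2| ^+ 2)).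
  by rewrite lerD2r lerD2l lerMn2r CS orbT.
by ring.
Qed.

Let hsum_normZ (a : R[i]) p : hsum_norm (a *: p) = `|a| * hsum_norm p.
Proof.
rewrite /hsum_norm /= !normrZ !exprMn -mulrDr sqrtCM ?qualifE/= ?exprn_ge0//.
by rewrite sqrCK.
Qed.

Let hsum_norm_eq0 p : hsum_norm p = 0 -> p = 0.
Proof.
move=> /eqP; rewrite sqrtC_eq0 paddr_eq0 ?exprn_ge0// !expf_eq0/= !normr_eq0.
by case: p => a b /= /andP[/eqP -> /eqP ->].
Qed.

HB.instance Definition _ := Lmodule_isNormed.Build R[i] (hsum H K)
  hsum_normD hsum_normZ hsum_norm_eq0.

Lemma hsum_normE p : `|p| = sqrtC (`|p.1| ^+ 2 + `|p.2| ^+ 2).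
Proof. by []. Qed.

Let norm_fst p : `|p.1| <= `|p|.
Proof.
by rewrite -(ler_pXn2r (n := 2)) ?nnegrE// hsum_normE sqrtCK lerDl exprn_ge0.
Qed.

Let norm_snd p : `|p.2| <= `|p|.
Proof.
by rewrite -(ler_pXn2r (n := 2)) ?nnegrE// hsum_normE sqrtCK lerDr exprn_ge0.
Qed.

Let norm_le_add p : `|p| <= `|p.1| + `|p.2|.
Proof.
rewrite -(ler_pXn2r (n := 2)) ?nnegrE ?addr_ge0// hsum_normE sqrtCK.
by rewrite sqrrD -addrA lerD2l lerDr mulrn_wge0 ?mulr_ge0.
Qed.

Let hsum_complete (F : set_system (hsum H K)) :
  ProperFilter F -> cauchy F -> cvg F.
Proof.
move=> FF /cauchyP Fc.
have cfst : cauchy ((fst : hsum H K -> H) @ F).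
  apply/cauchyP => e /Fc[p Fp]; exists p.1; apply: (@filterS _ F _ (ball p e)) => // q /=.
  rewrite -!ball_normE /=; exact: le_lt_trans (norm_fst (p - q)).
have csnd : cauchy ((snd : hsum H K -> K) @ F).
  apply/cauchyP => e /Fc[p Fp]; exists p.2; apply: (@filterS _ F _ (ball p e)) => // q /=.
  rewrite -!ball_normE /=; exact: le_lt_trans (norm_snd (p - q)).
have /cvg_ex[a Fa] : cvg ((fst : hsum H K -> H) @ F) by exact: cauchy_cvg.
have /cvg_ex[b Fb] : cvg ((snd : hsum H K -> K) @ F) by exact: cauchy_cvg.
apply/cvg_ex; exists ((a, b) : hsum H K); apply/cvgrPdist_lt => e e0.
have e20 : 0 < e / 2 by rewrite divr_gt0.
move/cvgrPdist_lt/(_ _ e20) : Fa; move/cvgrPdist_lt/(_ _ e20) : Fb.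
rewrite !near_map; apply: filterS2 => p /= pb pa.
apply: (le_lt_trans (norm_le_add _)) => /=.
by rewrite (splitr e) ltrD.
Qed.

HB.instance Definition _ := Uniform_isComplete.Build (hsum H K) hsum_complete.

Let hsum_dot_bilinear :
  bilinear_for *%R (@Num.conj R[i] \; *%R) hsum_dot.
Proof.
split=> p a q r; rewrite /hsum_dot /=.
  by rewrite !linearPl /= mulrDr addrACA.
by rewrite !linearPr /= mulrDr addrACA.
Qed.

HB.instance Definition _ := bilinear_isBilinear.Build R[i] (hsum H K)
  (hsum H K) R[i] *%R (@Num.conj R[i] \; *%R) hsum_dot hsum_dot_bilinear.

Let hsum_dot_herm p q :
  hsum_dot p q = (-1) ^+ false * Num.conj (hsum_dot q p).
Proof.
by rewrite expr0 mul1r /hsum_dot rmorphD/=; congr (_ + _);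
  rewrite [LHS]hermC expr0 mul1r.
Qed.

HB.instance Definition _ := isHermitianSesquilinear.Build R[i] (hsum H K)
  false (@Num.conj R[i]) hsum_dot hsum_dot_herm.

Let hsum_dot_normE p : `|p| ^+ 2 = hsum_dot p p.
Proof. by rewrite hsum_normE sqrtCK !hnormE. Qed.

Let hsum_dot_gt0 p : p != 0 -> 0 < hsum_dot p p.
Proof. by move=> p0; rewrite -hsum_dot_normE exprn_gt0// normr_gt0. Qed.

HB.instance Definition _ := isDotProduct.Build R[i] (hsum H K) hsum_dot
  hsum_dot_gt0.

HB.instance Definition _ := isHilbert.Build R (hsum H K) hsum_dot_normE.

End HilbertSum.

Definition hrel (R : realType) (H K : hilbertType R) := set (hsum H K).

Section Relations.
Variables (R : realType) (H K : hilbertType R).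
Implicit Type T : hrel H K.

Definition is_linear_relation T := GRing.submod_closed [in T].

Definition CR T := is_linear_relation T /\ closed T.

Definition hrel_dom T : set H := [set x | exists y, T (x, y)].
Definition hrel_ran T : set K := [set y | exists x, T (x, y)].
Definition hrel_ker T : set H := [set x | T (x, 0)].
Definition hrel_mul T : set K := [set y | T (0, y)].

Definition is_operator T := hrel_mul T = [set 0].

Definition hrel_inv T : hrel K H := [set (p.2, p.1) | p in T].

(* Norms have values in R[i]; complex.Re brings these (real) values back to R. *)
Definition rnorm (V : hilbertType R) (x : V) : R := complex.Re `|x|.

Definition bounded_operator T :=
  is_operator T /\
  exists c : R, forall x y, T (x, y) -> rnorm y <= c * rnorm x.

(* The norm, in the quotient of V by a closed subspace W, of the class of y. *)
Definition quotient_norm (V : hilbertType R) (W : set V) (y : V) : R :=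
  inf [set rnorm (y - w) | w in W].

(* Boundedness of Q_T T on D(T): Q_T T sends x to the class of y modulo the
   closure of M(T), for any y such that {x, y} is in T. *)
Definition BR T := exists c : R, forall x y, T (x, y) ->
  quotient_norm (closure (hrel_mul T)) y <= c * rnorm x.

End Relations.

(* As for composition of functions, S is applied first. *)
Definition hrel_comp (R : realType) (H K L : hilbertType R)
    (T : hrel K L) (S : hrel H K) : hrel H L :=
  [set p | exists z : K, S (p.1, z) /\ T (z, p.2)].

Definition orthoc (R : realType) (H : hilbertType R) (W : set H) : set H :=
  [set x | forall w, W w -> hdot x w = 0].

(* The graph of the orthogonal projection onto W; its domain is the sum of W and
   orthoc W, hence the whole space when W is a closed subspace. *)
Definition oproj (R : realType) (H : hilbertType R) (W : set H) :
    hrel H H :=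
  [set p | W p.2 /\ orthoc W (p.1 - p.2)].

Definition MPinverse (R : realType) (H K : hilbertType R) (T : hrel H K) :
    hrel K H :=
  hrel_comp (oproj (orthoc (hrel_ker T)))
            (hrel_comp (hrel_inv T) (oproj (hrel_ran T))).

Definition hrel_shift (R : realType) (X : hilbertType R) (S : hrel X X)
    (l : R[i]) : hrel X X :=
  [set (p.1, p.2 - l *: p.1) | p in S].

Definition resolvent_set (R : realType) (X : hilbertType R)
    (S : hrel X X) : set R[i] :=
  [set l | bounded_operator (hrel_inv (hrel_shift S l)) /\
           hrel_dom (hrel_inv (hrel_shift S l)) = setT].

Definition offdiag (R : realType) (H K : hilbertType R)
    (S : hrel K H) (T : hrel H K) :
    hrel (hsum H K) (hsum H K) :=
  [set p | exists (x : H) (y : K) (u : H) (z : K),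
     [/\ T (x, z), S (y, u) & p = ((x, y), (u, z))]].

(* Main.v *)
Require Import Defs.
From mathcomp Require Import all_boot all_order all_algebra.
From mathcomp Require Import complex.
From mathcomp Require Import all_classical all_reals all_analysis.
From mathcomp Require Import ring lra.
Set Implicit Arguments.
Unset Strict Implicit.
Unset Printing Implicit Defensive.
Import Order.TTheory GRing.Theory Num.Theory.
Import numFieldNormedType.Exports.
Local Open Scope classical_set_scope.
Local Open Scope ring_scope.
Local Open Scope complex_scope.

(** Write S for the Moore-Penrose inverse of T. A number l is in the resolvent
set of the off-diagonal relation exactly when the system
    {x, v + l y} in T,   {y, u + l x} in S
can be solved for every (u, v), with a solution bounded by the data
([resolvent_offdiagE]). Eliminating one unknown turns the system into an
equation for TS - l^2 or for ST - l^2.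

From left to right this elimination is all there is, and it works for any two
linear relations ([resolvent_offdiag_comp]): for l != 0 the right-hand sides
(0, v / l) and (u / l, 0) produce the solutions of the two equations, and for
l = 0 one solves for T and then for S.

From right to left, for l != 0, the solution for (u, v) is the sum of those for
(u, 0) and (0, v). In each of these one unknown is given by the resolvent of ST
or TS, and the other one is its image, up to the factor l, under T or S; to
bound it, T and S themselves have to be bounded ([resolvent_comp_offdiag]). The
case l = 0, in which T and S decouple, needs the same two bounds.

- T is bounded because it must be an operator: an element m of M(T) lies in
  R(T), so S maps it to 0, and {m, l^2 m} is in TS; hence m is in the kernel of
  TS - l^2 and m = 0 ([resolvent_comp_MPinverse_operator]). For an operator the
  quotient norm in the definition of continuity is the norm
  ([BR_operator_bounded]).
- S is everywhere defined by the projection theorem, applied to R(T) and N(T)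
  ([MPinverse_total]). It is an operator with closed graph, because {y, u} is in
  S iff u is orthogonal to N(T) and {u, p} is in T for the projection p of y on
  R(T) ([MPinverseE]). So the closed graph theorem bounds it ([closed_graph],
  [MPinverse_bounded]). *)

(** * Real-valued norm and inner product of a Hilbert space *)

Section Norm.
Context {R : realType} {V : hilbertType R}.
Implicit Types (x y : V) (a : R[i]).

Lemma rnormC x : (rnorm x)%:C = `|x|.
Proof. exact/RRe_real/normr_real. Qed.

Lemma rnorm_ge0 x : 0 <= rnorm x.
Proof. by rewrite -ler0c rnormC. Qed.

Lemma rnorm0 : rnorm (0 : V) = 0.
Proof. by rewrite /rnorm normr0. Qed.

Lemma rnorm_eq0 x : rnorm x = 0 -> x = 0.
Proof. by move=> x0; apply/normr0_eq0; rewrite -rnormC x0. Qed.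

Lemma rnorm_le0 x : rnorm x <= 0 -> x = 0.
Proof. by move=> x0; apply/rnorm_eq0/le_anti; rewrite x0 rnorm_ge0. Qed.

Lemma rnormD x y : rnorm (x + y) <= rnorm x + rnorm y.
Proof. by rewrite -lecR rmorphD/= !rnormC ler_normD. Qed.

Lemma rnormN x : rnorm (- x) = rnorm x.
Proof. by rewrite /rnorm normrN. Qed.

Lemma rnorm_distC x y : rnorm (x - y) = rnorm (y - x).
Proof. by rewrite /rnorm distrC. Qed.

Lemma rnormB x y : rnorm (x - y) <= rnorm x + rnorm y.
Proof. by rewrite -(rnormN y) rnormD. Qed.

Lemma rnorm_distD z x y : rnorm (x - y) <= rnorm (x - z) + rnorm (z - y).
Proof. by rewrite -[x - y](subrKA z) rnormD. Qed.

Lemma rnormZ a x : rnorm (a *: x) = Normc.normc a * rnorm x.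
Proof. by apply: complexI; rewrite rmorphM/= !rnormC normrZ. Qed.

Lemma normc_ge0 a : 0 <= Normc.normc a.
Proof. by rewrite -ler0c -[_%:C]/`|a|. Qed.

Lemma rnormZr (r : R) x : 0 <= r -> rnorm (r%:C *: x) = r * rnorm x.
Proof.
by move=> r0; apply: complexI; rewrite rmorphM/= !rnormC normrZ ger0_norm ?ler0c.
Qed.

Lemma dotC x y : hdot x y = Num.conj (hdot y x).
Proof. by rewrite hermC expr0 mul1r. Qed.

Lemma dot_eq0C {x y} : hdot x y = 0 -> hdot y x = 0.
Proof. by move=> xy; rewrite dotC xy rmorph0. Qed.

Lemma dotBl x y z : hdot (x - y) z = hdot x z - hdot y z.
Proof. exact: linearBl. Qed.

Lemma dotZl a x y : hdot (a *: x) y = a * hdot x y.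
Proof. exact: linearZl_LR. Qed.

Lemma rnorm_dot x : (rnorm x ^+ 2)%:C = hdot x x.
Proof. by rewrite rmorphXn/= rnormC hnormE. Qed.

Lemma dot_self_eq0 x : hdot x x = 0 -> x = 0.
Proof.
rewrite -rnorm_dot => /complexI/eqP; rewrite expf_eq0/= => /eqP.
exact: rnorm_eq0.
Qed.

Lemma pythagoras x y : hdot x y = 0 ->
  rnorm (x + y) ^+ 2 = rnorm x ^+ 2 + rnorm y ^+ 2.
Proof.
by move=> xy; apply: complexI; rewrite rmorphD/= !rnorm_dot hnormDd.
Qed.

Lemma parallelogram x y :
  rnorm (x + y) ^+ 2 + rnorm (x - y) ^+ 2 = (rnorm x ^+ 2 + rnorm y ^+ 2) *+ 2.
Proof.
apply: complexI; rewrite rmorphMn !rmorphD/= !rnorm_dot hnormD hnormB/=.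
by ring.
Qed.

(** Norms take values in [R[i]], while estimates are carried out in [R]: this
lemma and the next one translate closedness and completeness into real
epsilons. *)
Lemma closed_approx (A : set V) l : closed A ->
  (forall e : R, 0 < e -> exists2 a, A a & rnorm (l - a) < e) -> A l.
Proof.
move=> Acl Al; apply: Acl => B /nbhs_normP[e /= e0 eB].
have eE : (complex.Re e)%:C = e by exact/RRe_real/gtr0_real.
have [|a Aa la] := Al (complex.Re e); first by rewrite -ltcR eE.
by exists a; split=> //; apply: eB => /=; rewrite -rnormC -eE ltcR.
Qed.

(** Completeness together with the rate of convergence: nested balls, minimising
sequences and successive approximations all need the bound on the distance from
the limit to the terms. *)
Lemma cauchy_lim (u : nat -> V) (e : nat -> R) :
  (forall k m, (k <= m)%N -> rnorm (u m - u k) <= e k) ->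
  (forall d, 0 < d -> exists k, e k < d) ->
  exists l, forall k, rnorm (l - u k) <= e k.
Proof.
move=> ue e0.
have /cauchy_cvg/cvg_ex[l ul] : cauchy (u @ \oo).
  apply: cauchy_exP => d d0.
  have dE : (complex.Re d)%:C = d by exact/RRe_real/gtr0_real.
  have [|k ek] := e0 (complex.Re d); first by rewrite -ltcR dE.
  exists (u k); exists k => // m /= km.
  rewrite -ball_normE /= distrC -rnormC -dE ltcR.
  exact: le_lt_trans (ue _ _ km) ek.
exists l => k; apply/ler_addgt0Pl => d d0.
have dC : (0 : R[i]) < d%:C by rewrite ltcR.
move/cvgrPdist_lt : ul => /(_ _ dC)[N _ Nu].
have := Nu (maxn N k) (leq_maxl _ _) => /=.
rewrite -rnormC ltcR => /ltW lu.
by apply: le_trans (rnorm_distD (u (maxn N k)) _ _) (lerD lu (ue _ _ (leq_maxr _ _))).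
Qed.

End Norm.

(** * Projections on closed subspaces *)

Lemma invS_small {R : realType} (d : R) : 0 < d -> exists k, k.+1%:R^-1 < d.
Proof.
move=> d0; exists (Num.truncn d^-1).
by rewrite invf_plt ?posrE// truncnS_gt.
Qed.

Definition linear_subspace {R : realType} {V : lmodType R[i]} (W : set V) :=
  W 0 /\ forall a u v, W u -> W v -> W (a *: u + v).

Section Subspace.
Context {R : realType} {V : lmodType R[i]} {W : set V}.
Hypothesis Wsub : linear_subspace W.

Lemma linear_subspaceD u v : W u -> W v -> W (u + v).
Proof. by move=> Wu Wv; rewrite -[u]scale1r; apply: Wsub.2. Qed.

Lemma linear_subspaceZ a u : W u -> W (a *: u).
Proof. by move=> Wu; rewrite -[_ *: _]addr0; apply: Wsub.2 => //; case: Wsub. Qed.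

Lemma linear_subspaceB u v : W u -> W v -> W (u - v).
Proof. by move=> Wu Wv; rewrite -scaleN1r; apply/linear_subspaceD/linear_subspaceZ. Qed.

End Subspace.

Section Projection.
Context {R : realType} {V : hilbertType R}.
Implicit Types (x y : V) (W : set V).

Lemma linear_subspace_orthoc W : linear_subspace (orthoc W).
Proof.
split=> [w _|a u v Wu Wv w Ww]; first exact: linear0l.
by rewrite linearPl /= Wu// Wv// mulr0 addr0.
Qed.

(** If d were not orthogonal to v, subtracting from d its component along v would
make it strictly shorter, by Pythagoras. *)
Lemma orthoc_minimizer W d : linear_subspace W ->
  (forall v, W v -> rnorm d <= rnorm (d - v)) -> orthoc W d.
Proof.
move=> Wsub dmin v Wv; have [->|v0] := eqVneq v 0; first exact: linear0r.
have vv0 : hdot v v != 0 by apply: contra_neq v0; exact: dot_self_eq0.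
pose t := hdot d v / hdot v v.
have dtv : hdot (d - t *: v) (t *: v) = 0.
  by rewrite [LHS]linearZr_LR/= dotBl dotZl /t divfK// subrr mulr0.
have := pythagoras dtv; rewrite subrK => dE.
have : rnorm (t *: v) ^+ 2 <= 0.
  have : rnorm d ^+ 2 <= rnorm (d - t *: v) ^+ 2.
    by rewrite ler_pXn2r ?nnegrE ?rnorm_ge0// dmin//; exact: linear_subspaceZ.
  by rewrite dE gerDl.
rewrite exprn_even_le0//= => /eqP/rnorm_eq0/eqP.
rewrite scaler_eq0 (negPf v0) orbF /t mulf_eq0 invr_eq0 (negPf vv0) orbF.
exact: eqP.
Qed.

(** By the parallelogram law a sequence in W that minimises the distance to x is
Cauchy, the midpoint of two terms being again in W; its limit is the nearest
point of W, and [orthoc_minimizer] applies. *)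
Theorem projection W x : closed W -> linear_subspace W ->
  exists2 w, W w & orthoc W (x - w).
Proof.
move=> Wcl Wsub.
pose D := [set rnorm (x - w) ^+ 2 | w in W]; pose d := inf D.
have D0 : D !=set0 by exists (rnorm (x - 0) ^+ 2), 0 => //; case: Wsub.
have Dlb : has_lbound D by exists 0 => _ [w _ <-]; rewrite exprn_ge0 ?rnorm_ge0.
have dle w : W w -> d <= rnorm (x - w) ^+ 2.
  by move=> Ww; apply: (ge_inf Dlb); exists w.
pose e n : R := n.+1%:R^-1.
have e_gt0 n : 0 < e n by rewrite invr_gt0.
have e2_ge0 n : 0 <= e n / 2 by rewrite ltW// divr_gt0.
(* The excess (e n / 2)^2 makes the parallelogram law give the rate e n. *)
have /choice[w Ww] n : exists w, W w /\ rnorm (x - w) ^+ 2 < d + (e n / 2) ^+ 2.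
  have [|_ [w Ww <-] wd] := @inf_adherent _ D ((e n / 2) ^+ 2) _ (conj D0 Dlb).
    by rewrite exprn_gt0// divr_gt0.
  by exists w.
have wclose k m : (k <= m)%N -> rnorm (w m - w k) <= e k.
  move=> km; have [[Wk wk] [Wm wm]] := (Ww k, Ww m).
  have emk : (e m / 2) ^+ 2 <= (e k / 2) ^+ 2.
    rewrite ler_pXn2r ?nnegrE ?e2_ge0// ler_pM2r ?invr_gt0//.
    by rewrite /e lef_pV2 ?posrE// ler_nat.
  have mid : W (2^-1 *: (w k + w m)) by exact/linear_subspaceZ/linear_subspaceD.
  have := parallelogram (x - w k) (x - w m).
  rewrite (_ : x - w k - (x - w m) = w m - w k); last first.
    by rewrite opprB addrC addrA subrK.
  have -> : x - w k + (x - w m) = 2%:C *: (x - 2^-1 *: (w k + w m)).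
    have -> : 2%:C = 2 :> R[i] by rewrite rmorphMn rmorph1.
    rewrite scalerBr scalerA divff ?pnatr_eq0// scale1r scaler_nat mulr2n.
    by rewrite addrACA -opprD.
  rewrite rnormZr// exprMn => par.
  rewrite -(ler_pXn2r (n := 2)) ?nnegrE ?rnorm_ge0 ?(ltW (e_gt0 _))//.
  have := dle _ mid.
  move: par wk wm emk.
  rewrite !exprMn; set a := rnorm _ ^+ 2; set b := rnorm _ ^+ 2.
  by set f := rnorm _ ^+ 2; set g := rnorm _ ^+ 2; lra.
have [l lw] := cauchy_lim wclose (@invS_small R).
have Wl : W l.
  apply: closed_approx Wcl _ => h /invS_small[k kh]; exists (w k).
    by case: (Ww k).
  exact: le_lt_trans (lw k) kh.
exists l => //; apply: orthoc_minimizer => // v Wv.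
rewrite -addrA -opprD.
apply/ler_addgt0Pl => h h0.
have [k kh] : exists k, e k < h / 2 by apply: invS_small; rewrite divr_gt0.
apply: le_trans (rnorm_distD (w k) _ _) _.
rewrite (rnorm_distC (w k) l); have lk := lw k.
(* sqrt (d + (e k / 2)^2) is at most e k / 2 + sqrt d, and the distance from x
   to l + v is at least sqrt d. *)
suff : rnorm (x - w k) <= e k / 2 + rnorm (x - (l + v)).
  move: (e_gt0 k) lk kh; rewrite -/(e k); lra.
have ge0 := rnorm_ge0 (x - (l + v)).
rewrite -(ler_pXn2r (n := 2)) ?nnegrE ?rnorm_ge0 ?(addr_ge0 (e2_ge0 _))//.
apply: le_trans (ltW (Ww k).2) _.
rewrite sqrrD addrC -addrA lerD2l.
apply: le_trans (dle _ (linear_subspaceD Wsub Wl Wv)) _.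
by rewrite lerDr mulrn_wge0// mulr_ge0// divr_ge0// ltW.
Qed.

(** The residual of the projection on W of a vector orthogonal to W's complement
lies in that complement, hence is orthogonal to itself. *)
Lemma orthocK W : closed W -> linear_subspace W -> orthoc (orthoc W) `<=` W.
Proof.
move=> Wcl Wsub x Wx; have [w Ww xw] := projection x Wcl Wsub.
suff /subr0_eq -> : x - w = 0 by [].
apply: dot_self_eq0; rewrite dotBl Wx//; apply/eqP.
by rewrite sub0r oppr_eq0; apply/eqP/dot_eq0C/xw.
Qed.

(** The projection of x on W is not longer than the distance from x to any vector
orthogonal to W, so it vanishes. *)
Lemma orthoc_approx W x : closed W -> linear_subspace W ->
  (forall e : R, 0 < e -> exists2 u, orthoc W u & rnorm (x - u) < e) -> orthoc W x.
Proof.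
move=> Wcl Wsub xapp; have [w Ww xw] := projection x Wcl Wsub.
suff w0 : w = 0 by rewrite w0 subr0 in xw.
apply: rnorm_le0; apply/ler_addgt0Pl => e /xapp[u Wu /ltW xu].
rewrite addr0; apply: le_trans xu.
rewrite -(ler_pXn2r (n := 2)) ?nnegrE ?rnorm_ge0//.
have -> : x - u = (x - w - u) + w by rewrite addrAC subrK.
rewrite pythagoras ?lerDr ?exprn_ge0 ?rnorm_ge0//.
by rewrite dotBl xw// Wu// subrr.
Qed.

End Projection.

(** * Closed graph theorem *)

Section ClosedGraph.
Context {R : realType}.

(** Baire's argument: if every ball contained a smaller ball away from B n,
nested balls avoiding B 0, B 1, and so on would shrink to a point outside all of
them. *)
Lemma somewhere_dense (V : hilbertType R) (B : nat -> set V) :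
  (forall x, exists n, B n x) ->
  exists n a (r : R), 0 < r /\ forall x, rnorm (x - a) < r ->
    forall e : R, 0 < e -> exists2 b, B n b & rnorm (x - b) < e.
Proof.
move=> Bcov; apply: contrapT => nowhere.
have /choice[next nextP] (q : nat * (V * {posnum R})) :
    exists p : V * {posnum R}, [/\ rnorm (p.1 - q.2.1) + p.2%:num <= q.2.2%:num,
      p.2%:num <= q.1.+1%:R^-1 & forall b, B q.1 b -> p.2%:num < rnorm (p.1 - b)].
  case: q => n [a r] /=; apply: contrapT => noball; apply: nowhere.
  exists n, a, r%:num; split=> // x xa e e0; apply: contrapT => xB.
  pose s := Num.min (e / 2) (Num.min (r%:num - rnorm (x - a)) n.+1%:R^-1).
  have s0 : 0 < s by rewrite !lt_min divr_gt0// subr_gt0 xa invr_gt0/=.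
  apply: noball; exists (x, PosNum s0); split=> /=.
  - by rewrite -lerBrDl /s !ge_min lexx orbT.
  - by rewrite /s !ge_min lexx !orbT.
  - move=> b Bb; rewrite ltNge; apply/negP => xb; apply: xB; exists b => //.
    apply: le_lt_trans xb _; rewrite /s gt_min; apply/orP; left.
    by rewrite gtr_pMr// invf_lt1// ltr1n.
pose fix c n : V * {posnum R} :=
  if n is k.+1 then next (k, c k) else (0, PosNum (@ltr01 R)).
have cS n := nextP (n, c n).
have nested k m : (k <= m)%N ->
    rnorm ((c m).1 - (c k).1) + (c m).2%:num <= (c k).2%:num.
  move=> /subnK <-; elim: (m - k)%N => [|j IH].
    by rewrite add0n subrr rnorm0 add0r.
  have [/= next_in _ _] := cS (j + k)%N.
  apply: le_trans IH.
  apply: le_trans (lerD (rnorm_distD (c (j + k)%N).1 _ _) (lexx _)) _.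
  by rewrite addrAC addrC lerD2l.
have [||a ac] := @cauchy_lim _ _ (fun n => (c n.+1).1) (fun n => (c n.+1).2%:num).
- move=> k m km; apply: le_trans (nested k.+1 m.+1 km).
  by rewrite lerDl.
- move=> d /invS_small[k kd]; exists k; apply: le_lt_trans kd.
  by have [] := cS k.
have [n Bna] := Bcov a; have [_ _ /(_ _ Bna)] := cS n.
by rewrite rnorm_distC ltNge ac.
Qed.

(** Closedness of the graph is only needed at the points {0, y}, where it also
says that S is an operator. By [somewhere_dense] the vectors whose image is at most n in norm are dense in some
ball; taking differences and rescaling, every x is approximated up to half its
norm by a vector with image at most C |x|. Iterating on the residuals q k, which
tend to 0, their images form a Cauchy sequence whose limit must be 0, so the
image of x is bounded by the sum of the geometric series, 2 C |x|. *)
Theorem closed_graph (V W : hilbertType R) (S : hrel V W) : linear_subspace S ->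
  (forall x, exists y, S (x, y)) ->
  (forall y, (forall e : R, 0 < e ->
     exists p, [/\ S p, rnorm p.1 < e & rnorm (y - p.2) < e]) -> y = 0) ->
  exists2 c : R, 0 <= c & forall x y, S (x, y) -> rnorm y <= c * rnorm x.
Proof.
move=> Ssub Stot Scl.
have [|n [a [r [r0 dense]]]] := @somewhere_dense V
    (fun n => [set x | exists2 y, S (x, y) & rnorm y <= n%:R]).
  move=> x; have [y Sxy] := Stot x; exists (Num.truncn (rnorm y)).+1, y => //.
  by apply/ltW; rewrite truncnS_gt.
pose C := 4 * n%:R / r.
have C0 : 0 <= C by rewrite divr_ge0 ?mulr_ge0// ltW.
have /choice[g gP] x : exists p, [/\ S p, rnorm (x - p.1) <= rnorm x / 2 &
    rnorm p.2 <= C * rnorm x].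
  have [->|x0] := eqVneq x 0.
    exists (0, 0); split; first by case: Ssub.
    - by rewrite subrr rnorm0 mul0r.
    - by rewrite !rnorm0 mulr0.
  have nx0 : 0 < rnorm x.
    by rewrite lt_def rnorm_ge0 andbT; apply: contra_neq x0; exact: rnorm_eq0.
  (* x / t has norm r / 2, so that a + x / t and a are both in the ball. *)
  pose t := 2 * rnorm x / r; have t0 : 0 < t by rewrite divr_gt0// mulr_gt0.
  have tV : 0 <= t^-1 by rewrite invr_ge0 ltW.
  have r8 : 0 < r / 8 by rewrite divr_gt0.
  have [|b1 [y1 S1 ny1] xb1] := dense (a + t^-1%:C *: x) _ (r / 8) r8.
    rewrite addrAC subrr add0r rnormZr// /t invf_div.
    by rewrite invfM mulrA mulfVK ?gt_eqF//; lra.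
  have [|b2 [y2 S2 ny2] xb2] := dense a _ (r / 8) r8; first by rewrite subrr rnorm0.
  exists (t%:C *: ((b1, y1) - (b2, y2) : hsum V W)); split.
  - by apply: linear_subspaceZ => //; exact: linear_subspaceB.
  - have -> : x - t%:C *: (b1 - b2) =
        t%:C *: ((a + t^-1%:C *: x - b1) - (a - b2)).
      rewrite -[a + _ - b1]addrA opprB [a + (_ - b1)]addrC addrACA subrr addr0.
      rewrite -addrA [- b1 + _]addrC -[b2 - b1]opprB [RHS]scalerBr scalerA -rmorphM/=.
      by rewrite divff ?gt_eqF// rmorph1 scale1r.
    rewrite rnormZr ?(ltW t0)//; apply: le_trans (ler_wpM2l (ltW t0) (rnormB _ _)) _.
    rewrite /t; apply: le_trans (ler_wpM2l (ltW t0) (ltW (ltrD xb1 xb2))) _.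
    rewrite le_eqVlt; apply/orP; left; apply/eqP; rewrite /t; field.
    by rewrite gt_eqF.
  - rewrite rnormZr ?(ltW t0)//; apply: le_trans (ler_wpM2l (ltW t0) (rnormB _ _)) _.
    apply: le_trans (ler_wpM2l (ltW t0) (lerD ny1 ny2)) _.
    rewrite le_eqVlt; apply/orP; left; apply/eqP; rewrite /t /C; field.
    by rewrite gt_eqF.
exists (2 * C); first by rewrite mulr_ge0.
move=> x y Sxy.
pose fix q n : hsum V W := if n is k.+1 then q k - g (q k).1 else (x, y).
have Sq k : S (q k).
  by elim: k => [//|k IH] /=; apply: linear_subspaceB => //; have [] := gP (q k).1.
have q1 k : rnorm (q k).1 <= rnorm x / 2 ^+ k.
  elim: k => [|k IH] /=; first by rewrite expr0 divr1.
  have [_ qk _] := gP (q k).1; apply: le_trans qk _.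
  by rewrite exprSr invfM mulrA ler_pM2r// invr_gt0.
pose M := 2 * C * rnorm x.
have M0 : 0 <= M by rewrite mulr_ge0 ?rnorm_ge0// mulr_ge0.
have small (N d : R) : 0 <= N -> 0 < d -> exists k, N / 2 ^+ k < d.
  move=> N0 d0; have [|k kd] := @invS_small _ (d / (N + 1)).
    by rewrite divr_gt0// ltr_wpDl.
  have N1 : 0 < N + 1 by rewrite ltr_wpDl.
  exists k; rewrite ltr_pdivrMr ?exprn_gt0//.
  have : d^-1 * (N + 1) < k.+1%:R.
    by rewrite mulrC -[_ / d]invf_div invf_plt ?posrE ?divr_gt0.
  rewrite ltr_pdivrMl// => /lt_le_trans Nk.
  have : N + 1 < d * 2 ^+ k; last lra.
  by apply: Nk; rewrite ler_pM2l// -natrX ler_nat ltn_expl.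
have qM k m : (k <= m)%N -> rnorm ((q m).2 - (q k).2) <= M / 2 ^+ k.
  move=> km; suff : rnorm ((q m).2 - (q k).2) <= M / 2 ^+ k - M / 2 ^+ m.
    move=> /le_trans; apply; rewrite gerBl divr_ge0// exprn_ge0//.
  move: km => /subnK <-; elim: (m - k)%N => [|j IH].
    by rewrite add0n !subrr rnorm0.
  apply: le_trans (rnorm_distD (q (j + k)%N).2 _ _) _.
  have [_ _ gj] := gP (q (j + k)%N).1.
  rewrite /= addrAC subrr add0r rnormN.
  apply: le_trans (lerD gj IH) _.
  have /(ler_wpM2l C0) := q1 (j + k)%N.
  rewrite exprS invfM /M; lra.
have [w wq] := cauchy_lim qM (fun d => small M d M0).
have w0 : w = 0.
  apply: Scl => e e0; have [k ke] := small _ _ (addr_ge0 M0 (rnorm_ge0 x)) e0.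
  exists (q k); split=> //.
  - apply: le_lt_trans (q1 k) (le_lt_trans _ ke).
    by rewrite ler_pM2r ?invr_gt0 ?exprn_gt0// lerDr.
  - apply: le_lt_trans (wq k) (le_lt_trans _ ke).
    by rewrite ler_pM2r ?invr_gt0 ?exprn_gt0// lerDl rnorm_ge0.
by have := wq 0%N; rewrite w0 sub0r rnormN expr0 divr1.
Qed.

End ClosedGraph.

(** * Linear relations *)

Section LinearRelation.
Context {R : realType} {H K : hilbertType R}.
Implicit Type T : hrel H K.

Lemma rnorm_fst (x : H) (y : K) : rnorm x <= rnorm ((x, y) : hsum H K).
Proof.
rewrite -(ler_pXn2r (n := 2)) ?nnegrE ?rnorm_ge0// -lecR.
by rewrite !rmorphXn/= !rnormC hsum_normE sqrtCK/= lerDl exprn_ge0.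
Qed.

Lemma rnorm_snd (x : H) (y : K) : rnorm y <= rnorm ((x, y) : hsum H K).
Proof.
rewrite -(ler_pXn2r (n := 2)) ?nnegrE ?rnorm_ge0// -lecR.
by rewrite !rmorphXn/= !rnormC hsum_normE sqrtCK/= lerDr exprn_ge0.
Qed.

Lemma rnorm_pair (x : H) (y : K) :
  rnorm ((x, y) : hsum H K) <= rnorm x + rnorm y.
Proof.
have le1 : rnorm ((x, 0) : hsum H K) <= rnorm x.
  by rewrite -lecR !rnormC hsum_normE/= normr0 expr0n/= addr0 sqrCK.
have le2 : rnorm ((0, y) : hsum H K) <= rnorm y.
  by rewrite -lecR !rnormC hsum_normE/= normr0 expr0n/= add0r sqrCK.
apply: le_trans (lerD le1 le2).
have -> : ((x, y) : hsum H K) = (x, 0) + (0, y) by congr pair; rewrite /= ?addr0 ?add0r.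
exact: rnormD.
Qed.

Lemma linear_relation_subspace T : is_linear_relation T -> linear_subspace T.
Proof.
move=> [T0 TD]; have TE (p : hsum H K) : (p \in [in T]) = (p \in T) by [].
split=> [|a u v Tu Tv]; first by apply: set_mem; rewrite -TE.
by apply: set_mem; rewrite -TE; apply: TD; rewrite TE; apply: mem_set.
Qed.

Section Operations.
Variable T : hrel H K.
Hypothesis Tsub : linear_subspace T.

Lemma rel0 : T (0, 0). Proof. by case: Tsub. Qed.

Lemma relD x y x' y' : T (x, y) -> T (x', y') -> T (x + x', y + y').
Proof. exact: linear_subspaceD. Qed.

Lemma relB x y x' y' : T (x, y) -> T (x', y') -> T (x - x', y - y').
Proof. exact: linear_subspaceB. Qed.

Lemma relZ a x y : T (x, y) -> T (a *: x, a *: y).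
Proof. exact: linear_subspaceZ. Qed.

Lemma linear_subspace_ran : linear_subspace (hrel_ran T).
Proof.
split=> [|a u v [x Txu] [y Tyv]]; first by exists 0; exact: rel0.
by exists (a *: x + y); apply: relD => //; exact: relZ.
Qed.

Lemma linear_subspace_ker : linear_subspace (hrel_ker T).
Proof.
split=> [|a u v Tu Tv]; first exact: rel0.
have := relD (relZ a Tu) Tv; by rewrite scaler0 addr0.
Qed.

End Operations.

Lemma closed_rel_approx T x y : closed T -> (forall e : R, 0 < e ->
    exists x' y', [/\ T (x', y'), rnorm (x - x') < e & rnorm (y - y') < e]) ->
  T (x, y).
Proof.
move=> Tcl Txy; apply: closed_approx Tcl _ => e e0.
have [|x' [y' [Txy' xx' yy']]] := Txy (e / 2); first by rewrite divr_gt0.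
exists (x', y') => //; apply: le_lt_trans (rnorm_pair (x - x') (y - y')) _.
by rewrite (splitr e) ltrD.
Qed.

Lemma closed_ker T : closed T -> closed (hrel_ker T).
Proof.
move=> Tcl x xcl; apply: (closed_rel_approx Tcl) => e e0.
have eC : (0 : R[i]) < e%:C by rewrite ltcR.
have [a [Ta /=]] := xcl _ (nbhsx_ballx x e%:C eC).
rewrite -ball_normE/= -rnormC ltcR => xa.
by exists a, 0; split=> //; rewrite subrr rnorm0.
Qed.

(** When M(T) is 0, so is its closure, and the quotient norm is the norm. *)
Lemma BR_operator_bounded T : BR T -> is_operator T ->
  exists2 c : R, 0 <= c & forall x y, T (x, y) -> rnorm y <= c * rnorm x.
Proof.
move=> [c Tc] Top; exists `|c| => // x y /Tc.
rewrite [hrel_mul T]Top.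
have /closure_id <- : closed [set 0 : K].
  exact/accessible_closed_set1/hausdorff_accessible/norm_hausdorff.
rewrite /quotient_norm image_set1 inf1 subr0 => /le_trans; apply.
by rewrite ler_wpM2r ?rnorm_ge0// ler_norm.
Qed.

End LinearRelation.

(** * The Moore-Penrose inverse *)

Section MoorePenrose.
Context {R : realType} {H K : hilbertType R} {T : hrel H K}.
Hypotheses (Tcr : CR T) (Tran : closed (hrel_ran T)).

Let Tcl : closed T := Tcr.2.
Let Tsub : linear_subspace T := linear_relation_subspace Tcr.1.
Let kerT := linear_subspace_ker Tsub.
Let ranT := linear_subspace_ran Tsub.

(** Here u is the projection on the complement of N(T) of some x with {x, p} in T.
As N(T) is closed, x - u lies in N(T), so u is itself such an x, and the
composition of three relations reduces to one incidence in T. *)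
Lemma MPinverseE y u : MPinverse T (y, u) <->
  exists p, [/\ T (u, p), orthoc (hrel_ker T) u & orthoc (hrel_ran T) (y - p)].
Proof.
split=> [[x [[p [/= [Rp yp] [[x' p'] Tx' [px xx]]]] /= [ku xu]]]|].
  exists p; split=> //; have Txp : T (x, p) by move: Tx' => /=; rewrite -px -xx.
  have /= /(relB Tsub Txp) := orthocK (closed_ker Tcl) kerT xu.
  by rewrite subr0 opprB addrC subrK.
move=> [p [Tup ku yp]]; exists u; split=> /=.
  exists p; split=> /=; first by split=> //; exists u.
  by exists (u, p).
by split=> //; rewrite subrr; case: (linear_subspace_orthoc (orthoc (hrel_ker T))).
Qed.

Lemma linear_subspace_MPinverse : linear_subspace (MPinverse T).
Proof.
split=> [|a [y u] [y' u'] /MPinverseE[p [Tup ku yp]] /MPinverseE[p' [Tup' ku' yp']]].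
  apply/MPinverseE; exists 0; rewrite subr0.
  by split; [exact: rel0| |]; apply: (linear_subspace_orthoc _).1.
apply/MPinverseE; exists (a *: p + p'); split.
- by apply: relD => //; exact: relZ.
- by apply: (linear_subspace_orthoc _).2.
- have -> : a *: y + y' - (a *: p + p') = a *: (y - p) + (y' - p').
    by rewrite scalerBr addrACA -opprD.
  by apply: (linear_subspace_orthoc _).2.
Qed.

Lemma MPinverse_total y : exists u, MPinverse T (y, u).
Proof.
have [p [x Txp] yp] := projection y Tran ranT.
have [n /= Tn xn] := projection x (closed_ker Tcl) kerT.
exists (x - n); apply/MPinverseE; exists p; split=> //.
by rewrite -[p]subr0; exact: relB.
Qed.

(** If y tends to 0 then so does its projection p on R(T), so a limit w of the
values u has {w, 0} in T; but w is also orthogonal to N(T), hence w = 0. *)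
Lemma MPinverse_bounded : exists2 c : R, 0 <= c &
  forall y u, MPinverse T (y, u) -> rnorm u <= c * rnorm y.
Proof.
apply: closed_graph; first exact: linear_subspace_MPinverse.
  exact: MPinverse_total.
move=> w wapp.
have Tw : T (w, 0).
  apply: closed_rel_approx => // e /wapp[[y u] [/MPinverseE[p [Tup ku yp]] /= ye we]].
  exists u, p; split=> //; rewrite sub0r rnormN; apply: le_lt_trans ye.
  rewrite -(ler_pXn2r (n := 2)) ?nnegrE ?rnorm_ge0//.
  rewrite -[y](subrK p) pythagoras ?lerDr ?exprn_ge0 ?rnorm_ge0//.
  by apply: yp; exists u.
apply: dot_self_eq0; apply: (orthoc_approx (closed_ker Tcl) kerT) Tw => e.
by move=> /wapp[[y u] [/MPinverseE[p [Tup ku yp]] /= _ we]]; exists u.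
Qed.

End MoorePenrose.

(** * Resolvent sets *)

Section Resolvent.
Context {R : realType}.

(** Boundedness of the inverse already contains injectivity, as the origin
belongs to S. *)
Lemma resolventE (X : hilbertType R) (S : hrel X X) (l : R[i]) : S (0, 0) ->
  resolvent_set S l <->
  (exists2 c : R, 0 <= c & forall v w, S (v, w + l *: v) -> rnorm v <= c * rnorm w)
  /\ forall w, exists v, S (v, w + l *: v).
Proof.
move=> S00.
have invE w v : hrel_inv (hrel_shift S l) (w, v) <-> S (v, w + l *: v).
  split=> [[_ [[a b] Sab <-] /= [<- <-]]|Sv]; first by rewrite subrK.
  by exists (v, w); last by []; exists (v, w + l *: v); rewrite //= addrK.
split=> [[[_ [c cP]] dom]|[[c c0 cP] dom]].
  split=> [|w].
    exists `|c| => // v w /invE/cP/le_trans; apply.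
    by rewrite ler_wpM2r ?rnorm_ge0// ler_norm.
  have [v /invE Sv] : hrel_dom (hrel_inv (hrel_shift S l)) w by rewrite dom.
  by exists v.
split; last first.
  by apply/seteqP; split=> // w _; have [v Sv] := dom w; exists v; apply/invE.
split; last by exists c => w v /invE/cP.
apply/seteqP; split=> [v /invE/cP|_ ->]; last first.
  by apply/invE; rewrite scaler0 addr0.
by rewrite rnorm0 mulr0 => /rnorm_le0.
Qed.

Lemma resolvent_offdiagE (H K : hilbertType R) (T : hrel H K) (S : hrel K H)
    (l : R[i]) : T (0, 0) -> S (0, 0) ->
  resolvent_set (offdiag S T) l <->
  (exists2 c : R, 0 <= c & forall x y u v,
     T (x, v + l *: y) -> S (y, u + l *: x) ->
     rnorm x + rnorm y <= c * (rnorm u + rnorm v)) /\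
  forall u v, exists x y, T (x, v + l *: y) /\ S (y, u + l *: x).
Proof.
move=> T00 S00.
have offE (x : H) (y : K) (u : H) (z : K) :
    offdiag S T ((x, y), (u, z)) <-> T (x, z) /\ S (y, u).
  split=> [[x' [y' [u' [z' [Txz Syu [-> -> -> ->]]]]]]//|[Txz Syu]].
  by exists x, y, u, z.
rewrite resolventE; last exact/offE.
split=> [[[c c0 cP] dom]|[[c c0 cP] dom]]; split.
- exists (2 * c) => [|x y u v Tx Sy]; first by rewrite mulr_ge0.
  have := cP (x, y) (u, v) ((offE _ _ _ _).2 (conj Tx Sy)).
  have := ler_wpM2l c0 (rnorm_pair u v).
  have := rnorm_fst x y; have := rnorm_snd x y; lra.
- move=> u v; have [[x y] /offE[Tx Sy]] := dom (u, v); by exists x, y.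
- exists (2 * c) => [|[x y] [u v] /offE[Tx Sy]]; first by rewrite mulr_ge0.
  have := cP _ _ _ _ Tx Sy; have := rnorm_pair x y.
  have := ler_wpM2l c0 (rnorm_fst u v); have := ler_wpM2l c0 (rnorm_snd u v); lra.
- move=> [u v]; have [x [y [Tx Sy]]] := dom u v.
  by exists (x, y); apply/offE.
Qed.

(** For l != 0, an element {y, v + l^2 y} of TS with intermediate point s is a
solution of the system with right-hand side (0, v / l) and x = s / l. *)
Lemma resolvent_offdiag_comp (H K : hilbertType R) (T : hrel H K)
    (S : hrel K H) (l : R[i]) : linear_subspace T -> linear_subspace S ->
  resolvent_set (offdiag S T) l -> resolvent_set (hrel_comp T S) (l ^+ 2).
Proof.
move=> Tsub Ssub; have [T00 S00] := (rel0 Tsub, rel0 Ssub).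
rewrite resolvent_offdiagE// resolventE; last by exists 0.
move=> [[c c0 cP] dom].
have [l0|l0] := eqVneq l 0.
  have cP0 x y u v : T (x, v) -> S (y, u) ->
      rnorm x + rnorm y <= c * (rnorm u + rnorm v).
    by have := cP x y u v; rewrite l0 !scale0r !addr0.
  rewrite l0 expr0n/=; split.
    exists (c * c) => [|y v [s [/= Sys]]]; first exact: mulr_ge0.
    rewrite scale0r addr0 => Tsv.
    have := cP0 _ _ _ _ T00 Sys; rewrite !rnorm0 add0r addr0 => /le_trans; apply.
    rewrite -mulrA ler_wpM2l//.
    by have := cP0 _ _ _ _ Tsv S00; rewrite !rnorm0 addr0 add0r.
  move=> w; have [s [y0 []]] := dom 0 w; rewrite l0 !scale0r !addr0 => Tsw _.
  have [x0 [y []]] := dom s 0; rewrite l0 !scale0r !addr0 => _ Sys.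
  by exists y, s => /=; rewrite scale0r addr0.
split.
  exists (c * Normc.normc l^-1) => [|y v [s [/= Sys Tsv]]].
    by rewrite mulr_ge0// normc_ge0.
  have Tx : T (l^-1 *: s, l^-1 *: v + l *: y).
    have := relZ Tsub l^-1 Tsv.
    by rewrite scalerDr scalerA expr2 mulrA mulVf// mul1r.
  have := cP (l^-1 *: s) y 0 (l^-1 *: v) Tx.
  rewrite scalerA divff// scale1r add0r => /(_ Sys).
  rewrite rnorm0 add0r [rnorm (_ *: v)]rnormZ mulrA; apply: le_trans.
  by rewrite lerDr rnorm_ge0.
move=> w; have [x [y [Tx Sy]]] := dom 0 (l^-1 *: w).
exists y, (l *: x) => /=; split; first by rewrite add0r in Sy.
have := relZ Tsub l Tx.
by rewrite scalerDr !scalerA divff// scale1r.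
Qed.

(** Exchanging the summands exchanges T and S, so that what holds for TS also
gives the result for ST. *)
Lemma resolvent_offdiagC (H K : hilbertType R) (T : hrel H K) (S : hrel K H)
    (l : R[i]) : T (0, 0) -> S (0, 0) ->
  resolvent_set (offdiag S T) l -> resolvent_set (offdiag T S) l.
Proof.
move=> T00 S00; rewrite !resolvent_offdiagE// => -[[c c0 cP] dom]; split.
  exists c => // y x v u Sy Tx; rewrite addrC [_ + rnorm u]addrC; exact: cP.
by move=> v u; have [x [y [Tx Sy]]] := dom u v; exists y, x.
Qed.

(** For l = 0 the bounds on T and S give a comparison with the inverses of ST and
TS: a value v of T at x is continued by S, and a value u of
S at y by T, which is why the range of S has to lie in the domain of T. *)
Lemma resolvent_comp_offdiag (H K : hilbertType R) (T : hrel H K)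
    (S : hrel K H) (l : R[i]) : linear_subspace T -> linear_subspace S ->
  (exists2 c : R, 0 <= c & forall x z, T (x, z) -> rnorm z <= c * rnorm x) ->
  (exists2 c : R, 0 <= c & forall y u, S (y, u) -> rnorm u <= c * rnorm y) ->
  (forall y, exists u, S (y, u)) ->
  (forall y u, S (y, u) -> exists z, T (u, z)) ->
  resolvent_set (hrel_comp T S) (l ^+ 2) ->
  resolvent_set (hrel_comp S T) (l ^+ 2) ->
  resolvent_set (offdiag S T) l.
Proof.
move=> Tsub Ssub [t t0 Tt] [s s0 Ss] Stot SdomT.
have [T00 S00] := (rel0 Tsub, rel0 Ssub).
rewrite resolvent_offdiagE// resolventE; last by exists 0.
rewrite resolventE; last by exists 0.
move=> [[a a0 aP] domTS] [[b b0 bP] domST].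
have [l0|l0] := eqVneq l 0.
  rewrite l0 expr0n/= in aP bP domTS domST *; split.
    exists (b * s + a * t) => [|x y u v]; first by rewrite addr_ge0// mulr_ge0.
    rewrite !scale0r !addr0 => Txv Syu.
    have [w Svw] := Stot v; have [z Tuz] := SdomT _ _ Syu.
    have xw : rnorm x <= b * rnorm w.
      by apply: bP; exists v; rewrite scale0r addr0.
    have yz : rnorm y <= a * rnorm z.
      by apply: aP; exists u; rewrite scale0r addr0.
    have := ler_wpM2l b0 (Ss _ _ Svw); have := ler_wpM2l a0 (Tt _ _ Tuz).
    have := mulr_ge0 (mulr_ge0 b0 s0) (rnorm_ge0 u).
    have := mulr_ge0 (mulr_ge0 a0 t0) (rnorm_ge0 v).
    move: xw yz; rewrite !mulrA; lra.
  move=> u v; have [y0 [x [/= _]]] := domTS v; have [x0 [y [/= _]]] := domST u.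
  rewrite !scale0r !addr0 => Syu Txv.
  by exists x, y; rewrite !scale0r !addr0.
(* The solutions with right-hand sides (u, 0) and (0, v). *)
have colu u : exists x y, [/\ T (x, l *: y), S (y, u + l *: x),
    rnorm x <= b * (Normc.normc l * rnorm u)
  & rnorm y <= Normc.normc l^-1 * (t * (b * (Normc.normc l * rnorm u)))].
  have [x [z [/= Txz Szx]]] := domST (l *: u).
  have xb : rnorm x <= b * (Normc.normc l * rnorm u).
    by rewrite -rnormZ; apply: bP; exists z.
  exists x, (l^-1 *: z); split=> //.
  - by rewrite scalerA divff// scale1r.
  - have := relZ Ssub l^-1 Szx.
    by rewrite scalerDr !scalerA mulVf// scale1r expr2 mulrA mulVf// mul1r.
  - rewrite rnormZ ler_wpM2l ?normc_ge0//.
    exact: le_trans (Tt _ _ Txz) (ler_wpM2l t0 xb).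
have colv v : exists x y, [/\ T (x, v + l *: y), S (y, l *: x),
    rnorm y <= a * (Normc.normc l * rnorm v)
  & rnorm x <= Normc.normc l^-1 * (s * (a * (Normc.normc l * rnorm v)))].
  have [y [w [/= Syw Twy]]] := domTS (l *: v).
  have ya : rnorm y <= a * (Normc.normc l * rnorm v).
    by rewrite -rnormZ; apply: aP; exists w.
  exists (l^-1 *: w), y; split=> //.
  - have := relZ Tsub l^-1 Twy.
    by rewrite scalerDr !scalerA mulVf// scale1r expr2 mulrA mulVf// mul1r.
  - by rewrite scalerA divff// scale1r.
  - rewrite rnormZ ler_wpM2l ?normc_ge0//.
    exact: le_trans (Ss _ _ Syw) (ler_wpM2l s0 ya).
have uniq x y : T (x, l *: y) -> S (y, l *: x) -> x = 0 /\ y = 0.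
  move=> Txy Syx; split; apply: rnorm_le0.
    rewrite -(mulr0 b) -(rnorm0 (V := H)); apply: bP; exists (l *: y); split=> //=.
    by rewrite add0r expr2 -scalerA; exact: relZ.
  rewrite -(mulr0 a) -(rnorm0 (V := K)); apply: aP; exists (l *: x); split=> //=.
  by rewrite add0r expr2 -scalerA; exact: relZ.
split; last first.
  move=> u v; have [x [y [Txy Syx _ _]]] := colu u.
  have [x' [y' [Txy' Syx' _ _]]] := colv v.
  exists (x + x'), (y + y'); split.
    by rewrite scalerDr addrCA; exact: relD.
  by rewrite scalerDr addrA; exact: relD.
pose k := Normc.normc l; pose k' := Normc.normc l^-1.
have k0 : 0 <= k by exact: normc_ge0.
have k'0 : 0 <= k' by exact: normc_ge0.
exists (b * k + k' * (t * (b * k)) + a * k + k' * (s * (a * k))).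
  by rewrite !addr_ge0 ?mulr_ge0.
move=> x y u v Txy Syx.
have [x1 [y1 [Txy1 Syx1 nx1 ny1]]] := colu u.
have [x2 [y2 [Txy2 Syx2 ny2 nx2]]] := colv v.
have [/eqP ex /eqP ey] : x - (x1 + x2) = 0 /\ y - (y1 + y2) = 0.
  apply: uniq.
    rewrite scalerBr scalerDr -(addrKA v) [l *: y + v]addrC [v + (_ + _)]addrCA.
    exact: (relB Tsub Txy (relD Tsub Txy1 Txy2)).
  rewrite scalerBr scalerDr -(addrKA u) [l *: x + u]addrC [u + (_ + _)]addrA.
  exact: (relB Ssub Syx (relD Ssub Syx1 Syx2)).
move: ex ey; rewrite !subr_eq0 => /eqP-> /eqP->.
apply: le_trans (lerD (rnormD _ _) (rnormD _ _)) _.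
rewrite -/k -/k' in nx1 ny1 nx2 ny2.
have u0 := rnorm_ge0 u; have v0 := rnorm_ge0 v.
have := mulr_ge0 (mulr_ge0 b0 k0) v0.
have := mulr_ge0 (mulr_ge0 k'0 (mulr_ge0 t0 (mulr_ge0 b0 k0))) v0.
have := mulr_ge0 (mulr_ge0 a0 k0) u0.
have := mulr_ge0 (mulr_ge0 k'0 (mulr_ge0 s0 (mulr_ge0 a0 k0))) u0.
move: nx1 ny1 nx2 ny2; rewrite !mulrA; lra.
Qed.

End Resolvent.

(** For m in M(T) the pair {m, l m} is in the product, through the point 0. *)
Lemma resolvent_comp_MPinverse_operator (R : realType) (H K : hilbertType R)
    (T : hrel H K) (l : R[i]) : CR T ->
  resolvent_set (hrel_comp T (MPinverse T)) l -> is_operator T.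
Proof.
move=> Tcr; have Tsub := linear_relation_subspace Tcr.1.
have Ssub := linear_subspace_MPinverse Tcr.
rewrite resolventE; last by exists 0; split; exact: rel0.
move=> [[c c0 cP] _]; apply/seteqP; split=> [m Tm|_ ->]; last exact: rel0.
apply: rnorm_le0; rewrite -(mulr0 c) -(rnorm0 (V := K)); apply: cP.
exists 0; split=> /=; last by rewrite add0r -(scaler0 _ l); exact: relZ.
apply/MPinverseE => //; exists m; rewrite subrr.
by split=> //; apply: (linear_subspace_orthoc _).1.
Qed.

Theorem corollary4p2 (R : realType) (H K : hilbertType R) (T : hrel H K) :
  CR T -> BR T -> closed (hrel_ran T) ->
  resolvent_set (offdiag (MPinverse T) T) =
  [set l : R[i] | (resolvent_set (hrel_comp T (MPinverse T)) `&`
                   resolvent_set (hrel_comp (MPinverse T) T)) (l ^+ 2)].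
Proof.
move=> Tcr Tbr Tran; have Tsub := linear_relation_subspace Tcr.1.
have Ssub := linear_subspace_MPinverse Tcr.
have [T00 S00] := (rel0 Tsub, rel0 Ssub).
apply/seteqP; split=> l /=.
  move=> rl; split; first exact: resolvent_offdiag_comp rl.
  exact/resolvent_offdiag_comp/(resolvent_offdiagC T00 S00 rl).
move=> [rTS rST]; have Top := resolvent_comp_MPinverse_operator Tcr rTS.
apply: resolvent_comp_offdiag rTS rST => //.
- exact: BR_operator_bounded.
- exact: MPinverse_bounded.
- exact: MPinverse_total.
- by move=> y u /MPinverseE[]// p [Tup _ _]; exists p.
Qed.
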